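(* Suppose assumptions A1), A2), A3), A4), A5) and A6) (stated in the context) hold. Let $(s,z)\in[0,\infty)\times\mathbb{R}^n$ and let $(\bar x,\bar u)\in\mathcal{D}_{s,z;\infty}$ be given. If there exists a Dini sub-solution $\Phi$ of the HJB equation such that $$\Phi(s,z)=\int_s^\infty e^{-\delta t}\,l(t,\bar x(t),\bar u(t))\,dt,$$ then $(\bar x,\bar u)$ is an optimal process for problem $P_\infty(s,z)$, i.e. $J(\bar u;s,z)\le J(u;s,z)$ for every $(x,u)\in\mathcal{D}_{s,z;\infty}$.
   Context: Data: $l:[0,\infty)\times\mathbb{R}^n\times\mathbb{R}^m\to\mathbb{R}$ and $f:[0,\infty)\times\mathbb{R}^n\times\mathbb{R}^m\to\mathbb{R}^n$ are given functions, $\Omega\subset\mathbb{R}^m$ is a nonempty set (admissible control actions), and $\delta>0$ is the discount rate. For $(\tau,z)\in[0,\infty)\times\mathbb{R}^n$ let $U_{ad}[\tau,\infty):=\{w\in L^1_{loc}([\tau,\infty);\mathbb{R}^m) : w(t)\in\Omega \text{ a.e. in } [\tau,\infty)\}$. An admissible process for the initial condition $(\tau,z)$ is a pair $(x,u)$ with $u\in U_{ad}[\tau,\infty)$ and $x$ a (locally) absolutely continuous function on $[\tau,\infty)$ with $x(t)=z+\int_\tau^t f(s,x(s),u(s))\,ds$ for $t\ge\tau$. Its cost is $J(u;\tau,z):=\int_\tau^\infty e^{-\delta t}l(t,x(t),u(t))\,dt$. Problem $P_\infty(\tau,z)$ is to minimize $J(u;\tau,z)$ over admissible processes for $(\tau,z)$.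 Let $\mathcal{D}_{\tau,z;\infty}$ be the set of admissible processes $(x,u)$ for $(\tau,z)$ with $J(u;\tau,z)<\infty$. Hamiltonian: $\mathcal{H}(t,x,\lambda):=\inf_{u\in\Omega}\{\langle\lambda,f(t,x,u)\rangle+e^{-\delta t}l(t,x,u)\}$ for $(t,x,\lambda)\in[0,\infty)\times\mathbb{R}^n\times\mathbb{R}^n$. The HJB equation is $\partial_t v(t,x)+\mathcal{H}(t,x,\partial_x v(t,x))=0$, $(t,x)\in(0,\infty)\times\mathbb{R}^n$. For $\Phi:[0,\infty)\times\mathbb{R}^n\to\mathbb{R}$: the upper Dini derivative at $(t,x)$ in direction $(\alpha,\xi)\in\mathbb{R}^{1+n}$ is $D^+\Phi(t,x;\alpha,\xi):=\limsup_{r\downarrow0;\,w\to\xi}\frac{\Phi(t+r\alpha,x+rw)-\Phi(t,x)}{r}$. Dini super-gradient: $\partial^D\Phi(t,x):=\{(\alpha,\xi)\in\mathbb{R}^{1+n} : D^+\Phi(t,x;u,v)\le u\alpha+\langle v,\xi\rangle\ \forall(u,v)\in\mathbb{R}^{1+n}\}$. $\Phi$ is a Dini sub-solution of the HJB equation if it is continuous and: (a) for all $(\tau,z)\in[0,\infty)\times\mathbb{R}^n$, $\alpha+\mathcal{H}(\tau,z,\xi)\ge0$ for all $(\alpha,\xi)\in\partial^D\Phi(\tau,z)$; (b) $\Phi(\tau,z)\to0$ as $\tau\to\infty$, uniformly for $z$ in each compact subset of $\mathbb{R}^n$. Assumptions: A1) There exists $K_1>0$ such that for every $t\in[0,\infty)$,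 $u\in\Omega$: $|l(t,x,u)-l(t,z,u)|+|f(t,x,u)-f(t,z,u)|\le K_1|x-z|$ for all $x,z\in\mathbb{R}^n$. A2) There exists $K_2>0$ such that $|l(t,x,u)|+|f(t,x,u)|\le K_2(1+|x|)$ for all $t\in[0,\infty)$, $x\in\mathbb{R}^n$, $u\in\Omega$. A3) $l$ and $f$ are continuous. A4) For all $t,x$, the set $\{(e^{-\delta t}l(t,x,v),f(t,x,v))^T : v\in\Omega\}$ is convex in $\mathbb{R}^{n+1}$. A5) $\Omega$ is compact. A6) Given $(\tau,z)\in[0,\infty)\times\mathbb{R}^n$, there exists a bounded set $\mathcal{S}_{\tau,z}\subset\mathbb{R}^n$ such that every $(x,u)\in\mathcal{D}_{\tau,z;\infty}$ satisfies $x(t)\in\mathcal{S}_{\tau,z}$ for $t\ge\tau$. *)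

(* Defs.v *)
From HB Require Import structures.
From mathcomp Require Import all_boot all_order all_algebra.
From mathcomp Require Import all_classical all_reals all_analysis.

Set Implicit Arguments.
Unset Strict Implicit.
Unset Printing Implicit Defensive.

Import Order.TTheory GRing.Theory Num.Theory.
Import numFieldNormedType.Exports.

Local Open Scope classical_set_scope.
Local Open Scope ring_scope.

(* The library norm `|v| on 'rV[R]_n is the sup norm, so the Euclidean
   structure is introduced here; both norms induce the same topology and the
   same bounded sets. *)
Definition dotp (R : realType) (n : nat) (v w : 'rV[R]_n) : R :=
  \sum_(i < n) v ord0 i * w ord0 i.

Definition enorm (R : realType) (n : nat) (v : 'rV[R]_n) : R :=
  Num.sqrt (dotp v v).

Definition abs_continuous (R : realType) (n : nat) (a b : R)
    (x : R -> 'rV[R]_n) : Prop :=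
  forall e : R, 0 < e -> exists2 d : R, 0 < d &
    forall (N : nat) (p q : 'I_N -> R),
      (forall i, [/\ a <= p i, p i <= q i & q i <= b]) ->
      trivIset setT (fun i => `]p i, q i[%classic) ->
      \sum_(i < N) (q i - p i) < d ->
      \sum_(i < N) enorm (x (q i) - x (p i)) < e.

Definition vintegrable (R : realType) (k : nat) (D : set R)
    (g : R -> 'rV[R]_k) : Prop :=
  forall i, (@lebesgue_measure R).-integrable D (fun t => (g t ord0 i)%:E).

Definition vintegral (R : realType) (k : nat) (D : set R)
    (g : R -> 'rV[R]_k) : 'rV[R]_k :=
  \row_i (\int[@lebesgue_measure R]_(t in D) g t ord0 i).

(* Functions whose natural domain is [0, oo) x ... or [tau, oo) are total
   functions of which only the values on that domain are ever constrained. *)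
Section ControlProblem.
Variables (R : realType) (n m : nat).
Variables (l : R -> 'rV[R]_n -> 'rV[R]_m -> R)
          (f : R -> 'rV[R]_n -> 'rV[R]_m -> 'rV[R]_n)
          (Omega : set 'rV[R]_m) (delta : R).

Let mu := @lebesgue_measure R.

Definition admissible_control (tau : R) (u : R -> 'rV[R]_m) : Prop :=
  (forall T, tau <= T -> vintegrable `[tau, T] u) /\
  {ae mu, forall t, tau <= t -> Omega (u t)}.

Definition admissible_process (tau : R) (z : 'rV[R]_n)
    (x : R -> 'rV[R]_n) (u : R -> 'rV[R]_m) : Prop :=
  [/\ admissible_control tau u,
      forall T, tau <= T -> abs_continuous tau T x &
      forall t, tau <= t ->
        vintegrable `[tau, t] (fun s => f s (x s) (u s)) /\
        x t = z + vintegral `[tau, t] (fun s => f s (x s) (u s))].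

Definition discounted_cost (x : R -> 'rV[R]_n) (u : R -> 'rV[R]_m) (t : R) :
    \bar R :=
  (expR (- delta * t) * l t (x t) (u t))%:E.

Definition cost (tau : R) (x : R -> 'rV[R]_n) (u : R -> 'rV[R]_m) : \bar R :=
  (\int[mu]_(t in `[tau, +oo[) discounted_cost x u t)%E.

(* The library integral is total, with value -oo in the indeterminate case
   +oo - +oo; the following excludes that case. *)
Definition cost_exists (tau : R) (x : R -> 'rV[R]_n) (u : R -> 'rV[R]_m) :
    Prop :=
  measurable_fun (`[tau, +oo[%classic : set R) (fun t => expR (- delta * t) * l t (x t) (u t)) /\
  ((\int[mu]_(t in `[tau, +oo[) ((discounted_cost x u)^\+ t) < +oo)%E \/
   (\int[mu]_(t in `[tau, +oo[) ((discounted_cost x u)^\- t) < +oo)%E).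

Definition finite_cost_process (tau : R) (z : 'rV[R]_n)
    (x : R -> 'rV[R]_n) (u : R -> 'rV[R]_m) : Prop :=
  [/\ admissible_process tau z x u, cost_exists tau x u &
      (cost tau x u < +oo)%E].

Definition optimal_process (tau : R) (z : 'rV[R]_n)
    (x : R -> 'rV[R]_n) (u : R -> 'rV[R]_m) : Prop :=
  finite_cost_process tau z x u /\
  forall (y : R -> 'rV[R]_n) (w : R -> 'rV[R]_m),
    finite_cost_process tau z y w -> (cost tau x u <= cost tau y w)%E.

Definition hamiltonian (t : R) (x lambda : 'rV[R]_n) : \bar R :=
  ereal_inf [set (dotp lambda (f t x u) + expR (- delta * t) * l t x u)%:E
            | u in Omega].

(* The limsup is over points of the domain [0, oo) x R^n of Phi only: at t = 0
   in a direction with alpha < 0 there are none and the value is -oo. *)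
Definition upper_dini (Phi : R -> 'rV[R]_n -> R) (t : R) (x : 'rV[R]_n)
    (alpha : R) (xi : 'rV[R]_n) : \bar R :=
  limf_esup
    (fun p : R * 'rV[R]_n =>
       ((Phi (t + p.1 * alpha) (x + p.1 *: p.2) - Phi t x) / p.1)%:E)
    (within [set p : R * 'rV[R]_n | 0 <= t + p.1 * alpha]
            (filter_prod (0 : R)^'+ (nbhs xi))).

Definition dini_supergradient (Phi : R -> 'rV[R]_n -> R) (t : R)
    (x : 'rV[R]_n) : set (R * 'rV[R]_n) :=
  [set p | forall (a : R) (v : 'rV[R]_n),
     (upper_dini Phi t x a v <= (a * p.1 + dotp v p.2)%:E)%E].

Definition dini_subsolution (Phi : R -> 'rV[R]_n -> R) : Prop :=
  [/\ {within [set p : R * 'rV[R]_n | 0 <= p.1],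
         continuous (fun p => Phi p.1 p.2)},
      forall (tau : R) (z : 'rV[R]_n), 0 <= tau ->
        forall (alpha : R) (xi : 'rV[R]_n),
          dini_supergradient Phi tau z (alpha, xi) ->
          (0 <= alpha%:E + hamiltonian tau z xi)%E &
      forall K : set 'rV[R]_n, compact K ->
        {uniform K, Phi @ +oo --> (fun _ : 'rV[R]_n => 0 : R)}].

Definition lipschitz_data : Prop :=
  exists2 K1 : R, 0 < K1 &
    forall (t : R) (u : 'rV[R]_m), 0 <= t -> Omega u ->
    forall x z : 'rV[R]_n,
      `|l t x u - l t z u| + enorm (f t x u - f t z u) <= K1 * enorm (x - z).

Definition linear_growth_data : Prop :=
  exists2 K2 : R, 0 < K2 &
    forall (t : R) (x : 'rV[R]_n) (u : 'rV[R]_m), 0 <= t -> Omega u ->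
      `|l t x u| + enorm (f t x u) <= K2 * (1 + enorm x).

Definition continuous_data : Prop :=
  {within [set p : R * 'rV[R]_n * 'rV[R]_m | 0 <= p.1.1],
     continuous (fun p => l p.1.1 p.1.2 p.2)} /\
  {within [set p : R * 'rV[R]_n * 'rV[R]_m | 0 <= p.1.1],
     continuous (fun p => f p.1.1 p.1.2 p.2)}.

Definition convex_data : Prop :=
  forall (t : R) (x : 'rV[R]_n), 0 <= t ->
    @convex_set R (R^o * 'rV[R]_n)%type
      [set (expR (- delta * t) * l t x v, f t x v) | v in Omega].

Definition bounded_finite_cost_states : Prop :=
  forall (tau : R) (z : 'rV[R]_n), 0 <= tau ->
    exists2 S : set 'rV[R]_n, bounded_set S &
      forall (x : R -> 'rV[R]_n) (u : R -> 'rV[R]_m),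
        finite_cost_process tau z x u -> forall t, tau <= t -> S (x t).

End ControlProblem.

(* Main.v *)
Require Import Defs.
From HB Require Import structures.
From mathcomp Require Import all_boot all_order all_algebra.
From mathcomp Require Import all_classical all_reals all_analysis.
From mathcomp Require Import measurable_realfun ring lra.

Set Implicit Arguments.
Unset Strict Implicit.
Unset Printing Implicit Defensive.

Import Order.TTheory GRing.Theory Num.Theory.
Import numFieldNormedType.Exports.

Local Open Scope classical_set_scope.
Local Open Scope ring_scope.

(** A Dini sub-solution [Phi] bounds the cost of every process from below.
    Along an admissible trajectory [y] driven by [w] the running quantity
    [Phi t (y t) + \int_s^t L], where [L t x u] is the discounted running cost
    [expR (- delta * t) * l t x u], does not decrease, so that
    [Phi s z <= Phi T (y T) + \int_s^T L] for all [T].  As [T] tends to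
    infinity the states remain in a bounded set, hence [Phi T (y T)] tends to
    [0], while the discount makes the tail of the cost vanish: this gives
    [Phi s z <= cost] ([subsolution_le_cost]).  A process whose cost equals
    [Phi s z] is therefore optimal.

    The monotonicity would follow from the chain rule if [Phi] were smooth and
    [w] continuous.  Here [Phi] is only continuous and [w] only measurable, and
    both difficulties are met on a short interval [a, b].  There, [y] is
    replaced by its affine interpolation [p], which is smooth and has the right
    end points, and [Phi] is penalised: [Phi t (p t + x) - N * |x|^2] is
    maximised over [|x| <= rho].  If the maximum decreased too much between [a]
    and [b], then after the addition of a suitable decreasing function of time
    it would be attained at an interior point [(t0, x0)]
    ([viscosity_mean_value]); there a quadratic function touches [Phi] from
    above, which produces an explicit supergradient [(alpha, 2 N x0)]
    ([touching_supergradient]).  The sub-solution inequality at this single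
    point holds for every control value, in particular for almost every [w r]
    with [r] in [a, b].  Replacing [f t0 (p t0 + x0) (w r)] by
    [f r (y r) (w r)] costs an error bounded by the Lipschitz constant and the
    modulus of continuity in time, and then integrating in [r] turns
    [f r (y r) (w r)] into [y b - y a], that is, into the slope of [p]: no
    approximation of the control is required ([trajectory_step]).  The error is
    small because [N * |x0|^2] is bounded by the oscillation of [Phi] on balls
    of radius [rho], whatever [N].  Chaining the short intervals
    ([fine_chaining]) yields the estimate on [s, T]
    ([finite_horizon_bound]). *)

(** * The Euclidean product against the sup norm *)

Section dotp.
Context {R : realType} {n : nat}.
Implicit Types (u v w : 'rV[R]_n) (a : R).

Lemma dotpC v w : dotp v w = dotp w v.
Proof. by apply: eq_bigr => i _; rewrite mulrC. Qed.

Lemma dotpDl u v w : dotp (u + v) w = dotp u w + dotp v w.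
Proof. by rewrite -big_split; apply: eq_bigr => i _; rewrite mxE mulrDl. Qed.

Lemma dotpZl a v w : dotp (a *: v) w = a * dotp v w.
Proof.
by rewrite /dotp mulr_sumr; apply: eq_bigr => i _; rewrite mxE mulrA.
Qed.

Lemma dotpDr u v w : dotp u (v + w) = dotp u v + dotp u w.
Proof. by rewrite dotpC dotpDl !(dotpC u). Qed.

Lemma dotpZr a v w : dotp v (a *: w) = a * dotp v w.
Proof. by rewrite dotpC dotpZl dotpC. Qed.

Lemma dotp0l v : dotp 0 v = 0.
Proof. by rewrite -(scale0r 0) dotpZl mul0r. Qed.

Lemma dotp_sqrD v w :
  dotp (v + w) (v + w) = dotp v v + 2 * dotp v w + dotp w w.
Proof. by rewrite dotpDl !dotpDr (dotpC w v); ring. Qed.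

Lemma coord_le_norm v i : `|v ord0 i| <= `|v|.
Proof.
rewrite -[X in _ <= X]/(mx_norm v) mx_normrE.
exact: (@le_bigmax _ _ _ 0 (fun i => `|v i.1 i.2|) (ord0, i)).
Qed.

Lemma norm_le_coord v (r : R) : 0 <= r -> (forall i, `|v ord0 i| <= r) ->
  `|v| <= r.
Proof.
move=> r0 vr; rewrite -[X in X <= _]/(mx_norm v) mx_normrE.
by apply/bigmax_leP; split => // -[i j] _ /=; rewrite (ord1 i).
Qed.

Lemma normr_dotp v w : `|dotp v w| <= n%:R * (`|v| * `|w|).
Proof.
apply: (le_trans (ler_norm_sum _ _ _)).
apply: (@le_trans _ _ (\sum_(i < n) `|v| * `|w|)).
  by apply: ler_sum => i _; rewrite normrM ler_pM// coord_le_norm.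
by rewrite sumr_const card_ord mulr_natl.
Qed.

Lemma dotp_ge0 v : 0 <= dotp v v.
Proof. by apply: sumr_ge0 => i _; rewrite -expr2 sqr_ge0. Qed.

Lemma norm_le_enorm v : `|v| <= enorm v.
Proof.
apply: norm_le_coord => [|i]; first exact: sqrtr_ge0.
rewrite -sqrtr_sqr ler_sqrt ?dotp_ge0// expr2 /dotp (bigD1 i)//=.
by rewrite lerDl sumr_ge0// => j _; rewrite -expr2 sqr_ge0.
Qed.

Lemma sqr_norm_le_dotp v : `|v| ^+ 2 <= dotp v v.
Proof.
rewrite -[leRHS]sqr_sqrtr ?dotp_ge0//.
by rewrite ler_pXn2r ?nnegrE ?sqrtr_ge0// norm_le_enorm.
Qed.

Lemma enorm_le_norm v : enorm v <= n.+1%:R * `|v|.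
Proof.
rewrite -[leRHS]ger0_norm ?mulr_ge0// -sqrtr_sqr ler_sqrt ?sqr_ge0//.
apply: (le_trans (ler_norm _)); apply: (le_trans (normr_dotp _ _)).
rewrite exprMn -expr2 ler_wpM2r ?sqr_ge0// expr2 -natrM ler_nat.
by rewrite mulnS leqW// leq_addr.
Qed.

End dotp.

(** * Uniform continuity on compact sets *)

(** Heine-Cantor for a function that is only known to be continuous within the
    compact set: the radius can be chosen locally, and the covering form of
    compactness makes one radius work for all points. *)
Lemma compact_unif_cont (R : realType) (X : pseudoMetricType R)
    (Y : normedModType R) (K : set X) (g : X -> Y) (e : R) :
  compact K -> {within K, continuous g} -> 0 < e ->
  exists2 d, 0 < d & forall p q, K p -> K q -> ball p d q -> `|g p - g q| < e.
Proof.
move=> /compact_near_coveringP/near_covering_withinP cK cg e0.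
pose P d p := forall q, K q -> ball p d q -> `|g p - g q| < e.
suff nearP : \forall d \near (0 : R)^'+, K `<=` P d.
  near (0 : R)^'+ => d; exists d; first by near: d; exact: nbhs_right_gt.
  by move=> p q Kp; apply: (near nearP d).
apply: cK => p Kp.
have /cvgrPdist_lt/(_ (e / 2)) : g q @[q --> within K (nbhs p)] --> g p.
  have := cg p; rewrite /continuous_at /=.
  by rewrite nbhs_subspace_in.
rewrite divr_gt0// => /(_ isT) /nbhs_ballP[r /= r0 rP].
exists (ball p (r / 2), [set d | d < r / 2]) => /=.
  split; first by apply: nbhsx_ballx; rewrite divr_gt0.
  by apply: nbhs_right_lt; rewrite divr_gt0.
move=> [p' d] /= [pp' dr] Kp' q Kq p'q.
have pp'r : ball p r p' by apply: le_ball pp'; lra.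
have pqr : ball p r q.
  rewrite (splitr r); apply: ball_triangle pp' _.
  by apply: le_ball p'q; exact: ltW.
rewrite (splitr e); apply: (le_lt_trans (ler_distD (g p) _ _)).
by apply: ltrD; [rewrite distrC|]; apply: rP.
Unshelve. all: by end_near. Qed.

(** * Supergradients and the mean value inequality *)

Section supergradient.
Context {R : realType} {n : nat}.
Implicit Types (Phi : R -> 'rV[R]_n -> R).

(** In a direction [(a, v)] the difference quotients of the touching function
    are [a * alpha + dotp xi w] plus a remainder linear in the step [r], both
    controlled uniformly for [w] near [v]. *)
Lemma touching_supergradient Phi (t0 : R) (X0 : 'rV[R]_n) (alpha : R)
    (xi : 'rV[R]_n) (C r0 : R) :
  0 < r0 -> 0 <= C ->
  (forall t X, 0 <= t -> `|t - t0| < r0 -> `|X - X0| < r0 ->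
    Phi t X <= Phi t0 X0 + alpha * (t - t0) + dotp xi (X - X0)
               + C * ((t - t0) ^+ 2 + `|X - X0| ^+ 2)) ->
  dini_supergradient Phi t0 X0 (alpha, xi).
Proof.
move=> r00 C0 touch a v /=; apply/lee_addgt0Pr => e e0.
rewrite /upper_dini /limf_esup.
pose M := `|v| + 1.
have M0 : 0 < M by rewrite ltr_wpDl.
pose d := Num.min 1 (e / 2 / (n%:R * `|xi| + 1)).
have nxi0 : 0 < n%:R * `|xi| + 1 by rewrite ltr_wpDl// mulr_ge0.
have d0 : 0 < d by rewrite lt_min ltr01/= !divr_gt0.
have P0 : 0 < C * (a ^+ 2 + M ^+ 2) + 1.
  by rewrite ltr_wpDl// mulr_ge0// addr_ge0// sqr_ge0.
pose V := [set p : R * 'rV[R]_n |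
  (((Phi (t0 + p.1 * a) (X0 + p.1 *: p.2) - Phi t0 X0) / p.1)
    <= a * alpha + dotp v xi + e)].
apply: (@le_trans _ _ (ereal_sup
    ((fun p : R * 'rV[R]_n =>
       ((Phi (t0 + p.1 * a) (X0 + p.1 *: p.2) - Phi t0 X0) / p.1)%:E) @` V))).
  apply: ereal_inf_lbound; exists V => //.
  suff : \forall r \near (0 : R)^'+, forall w, `|v - w| < d ->
      0 <= t0 + r * a -> V (r, w).
    move=> H; exists ([set r | forall w, `|v - w| < d ->
      0 <= t0 + r * a -> V (r, w)], ball v d) => /=.
      by split => //; exact: nbhsx_ballx.
    move=> [r w] /= [rH vw]; apply: rH => //.
    by move: vw; rewrite -ball_normE.
  near=> r => w vw ta; rewrite /V /=.
  have r_gt0 : 0 < r by near: r; exact: nbhs_right_gt.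
  have rM : r * M < r0.
    by rewrite -ltr_pdivlMr//; near: r; apply: nbhs_right_lt; rewrite divr_gt0.
  have ra : r * `|a| < r0.
    have : r * (`|a| + 1) < r0.
      rewrite -ltr_pdivlMr ?ltr_wpDl//; near: r; apply: nbhs_right_lt.
      by rewrite divr_gt0// ltr_wpDl.
    by apply: le_lt_trans; rewrite ler_pM2l// lerDl.
  have rC : r * (C * (a ^+ 2 + M ^+ 2)) <= e / 2.
    have : r * (C * (a ^+ 2 + M ^+ 2) + 1) < e / 2.
      rewrite -ltr_pdivlMr//; near: r; apply: nbhs_right_lt.
      by rewrite !divr_gt0//.
    by move=> /ltW; apply: le_trans; rewrite ler_pM2l// lerDl.
  have wM : `|w| <= M.
    have : `|v - w| < 1 by apply: lt_le_trans vw _; rewrite ge_min lexx.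
    have := ler_distD v w 0; rewrite !subr0 (distrC w) /M; lra.
  have := touch (t0 + r * a) (X0 + r *: w) ta.
  rewrite !(addrC t0) !(addrC X0) !addrK normrM normrZ (gtr0_norm r_gt0).
  have -> : r * `|w| < r0 by apply: le_lt_trans rM; rewrite ler_pM2l.
  move=> /(_ ra isT); rewrite -lerBlDl => Hle.
  rewrite ler_pdivrMr//.
  have dvw : dotp xi w <= dotp v xi + e / 2.
    rewrite (dotpC v) -lerBlDl.
    have -> : dotp xi w - dotp xi v = dotp xi (w - v).
      by rewrite dotpDr -(scaleN1r v) dotpZr mulN1r.
    apply: (le_trans (ler_norm _)); apply: (le_trans (normr_dotp _ _)).
    rewrite mulrA distrC.
    apply: (@le_trans _ _ ((n%:R * `|xi| + 1) * d)).
      by apply: ler_pM; rewrite ?mulr_ge0// ?lerDl// ltW.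
    by rewrite mulrC -ler_pdivlMr// ge_min lexx orbT.
  have wM2 : `|w| ^+ 2 <= M ^+ 2 by rewrite ler_pXn2r// nnegrE// ltW.
  have rC' : C * ((r * a) ^+ 2 + (r * `|w|) ^+ 2) <= e / 2 * r.
    apply: (@le_trans _ _ (r * (C * (a ^+ 2 + M ^+ 2)) * r)); last first.
      by rewrite ler_pM2r.
    rewrite !exprMn -mulrDr.
    have -> : C * (r ^+ 2 * (a ^+ 2 + `|w| ^+ 2)) =
      r * (C * (a ^+ 2 + `|w| ^+ 2)) * r by ring.
    by rewrite ler_pM2r// ler_pM2l// ler_wpM2l// lerD2l.
  have rd : r * dotp xi w <= r * (dotp v xi + e / 2) by rewrite ler_pM2l.
  move: Hle; rewrite dotpZr => Hle.
  nra.
apply: ge_ereal_sup => _ [p Vp <-].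
by rewrite -EFinD lee_fin; exact: Vp.
Unshelve. all: by end_near. Qed.

End supergradient.

Section mean_value.
Context {R : realType} {n : nat}.

Lemma compact_norm_le (r : R) : compact [set x : 'rV[R]_n | `|x| <= r].
Proof.
apply: bounded_closed_compact.
  exists r; split; first exact: num_real.
  by move=> M rM x /= xr; apply: (le_trans xr); exact: ltW.
rewrite (_ : mkset _ = Num.norm @^-1` [set y | y <= r])//.
by apply: closed_comp => [x _|]; [exact: norm_continuous|exact: closed_le].
Qed.

Lemma continuous_dotp : continuous (fun x : 'rV[R]_n => dotp x x).
Proof.
apply: (@continuous_big R _ +%R 0 predT) => [|i _]; first exact: add_continuous.
move=> x; have ci := @coord_continuous R 1 n ord0 i x.
exact: (@continuousM R _ (fun x : 'rV[R]_n => x ord0 i) _ x ci ci).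
Qed.

(** The derivative of [max (u, 0) ^ 2] is [2 max (u, 0)], with a one-sided
    quadratic remainder; this is all that touching from above requires. *)
Lemma sqr_posp_le (u h : R) :
  Num.max (u - h) 0 ^+ 2 <= Num.max u 0 ^+ 2 - 2 * Num.max u 0 * h + h ^+ 2.
Proof.
have [uh|uh] := leP (u - h) 0; have [u0|u0] := leP u 0; nra.
Qed.

Lemma within_continuous_along_line (Phi : R -> 'rV[R]_n -> R)
    (ya c : 'rV[R]_n) (a : R) (Q : set (R * 'rV[R]_n)) :
  (forall q, Q q -> 0 <= q.1) ->
  {within [set q : R * 'rV[R]_n | 0 <= q.1],
    continuous (fun q => Phi q.1 q.2)} ->
  {within Q, continuous
    (fun q : R * 'rV[R]_n => Phi q.1 (ya + (q.1 - a) *: c + q.2))}.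
Proof.
move=> Q0 cPhi; pose p (t : R) : 'rV[R]_n := ya + (t - a) *: c.
have contp : continuous (fun q : R * 'rV[R]_n => (q.1, p q.1 + q.2)).
  move=> q; apply: (@cvg_pair _ _ _ (nbhs q) (nbhs q.1) (nbhs (p q.1 + q.2))).
    exact: cvg_fst.
  have cp : {for q, continuous (fun q : R * 'rV[R]_n => p q.1)}.
    apply: (@continuousD R 'rV[R]_n _ (fun=> ya)); first exact: cst_continuous.
    apply: (@continuousZr_tmp R 'rV[R]_n _ (fun q : R * 'rV[R]_n => q.1 - a)).
    by apply: cvgB; [exact: cvg_fst|exact: cvg_cst].
  have cs : {for q, continuous (@snd R 'rV[R]_n)} by exact: cvg_snd.
  exact: (@continuousD R 'rV[R]_n _ (fun q : R * 'rV[R]_n => p q.1) _ q cp cs).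
apply/subspace_continuousP => q Qq.
have Phiq := (subspace_continuousP _ _).1 cPhi (q.1, p q.1 + q.2) (Q0 _ Qq).
apply: (cvg_comp (fun q => (q.1, p q.1 + q.2)) _ _ Phiq).
move=> U /contp qU; apply: (@filterS _ (nbhs q) _ _ _ _ qU).
by move=> q' q'U /Q0/q'U.
Qed.

(** If the maximum over the tube of radius [rho] around the segment [p] of the
    penalised function decreases from [a] to [b] by more than [lam * (b - a)],
    then some interior point of the tube carries a supergradient whose
    derivative along [p] is at most [- lam].  The penalty forces
    [N * |x0|^2 <= eta], since the value at [x0] is at least the value at
    [x = 0], where [Phi] is lower than at [x0] by at most [eta]; with
    [eta < N * rho^2] this keeps [x0] off the boundary of the ball. *)
Lemma viscosity_mean_value (Phi : R -> 'rV[R]_n -> R) (a b : R)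
    (ya c : 'rV[R]_n) (lam N rho eta : R) (xa : 'rV[R]_n) :
  let p (t : R) : 'rV[R]_n := ya + (t - a) *: c in
  0 <= a -> a < b -> 0 < N -> 0 < rho -> eta < N * rho ^+ 2 ->
  {within [set q : R * 'rV[R]_n | 0 <= q.1],
    continuous (fun q => Phi q.1 q.2)} ->
  (forall t (x : 'rV[R]_n), a <= t <= b -> `|x| <= rho ->
    Phi t (p t + x) <= Phi t (p t) + eta) ->
  `|xa| <= rho ->
  (forall xb : 'rV[R]_n, `|xb| <= rho ->
    Phi b (p b + xb) - N * dotp xb xb + lam * (b - a) <
    Phi a (p a + xa) - N * dotp xa xa) ->
  exists (t0 : R) (x0 : 'rV[R]_n) (alpha : R),
    [/\ a < t0 < b, `|x0| <= rho, N * `|x0| ^+ 2 <= eta,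
    dini_supergradient Phi t0 (p t0 + x0) (alpha, (2 * N) *: x0) &
    alpha + dotp ((2 * N) *: x0) c + lam <= 0].
Proof.
move=> p a0 ab N0 rho0 etaN cPhi osc xar drop.
pose B := [set x : 'rV[R]_n | `|x| <= rho].
have cB : compact B by exact: compact_norm_le.
pose Q := `[a, b] `*` B.
have cQ : compact Q by apply: compact_setX => //; exact: segment_compact.
pose G (q : R * 'rV[R]_n) :=
  Phi q.1 (p q.1 + q.2) - N * dotp q.2 q.2 + lam * (q.1 - a).
have Q0 q : Q q -> 0 <= q.1.
  by case=> /=; rewrite in_itv/= => /andP[aq _] _; exact: le_trans aq.
have cG : {within Q, continuous G}.
  apply/subspace_continuousP => q Qq; apply: cvgD; [apply: cvgB|].
  - exact: (subspace_continuousP _ _).1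
      (within_continuous_along_line Q0 cPhi) q Qq.
  - apply: (@cvg_within_filter _ _ _ (nbhs q)).
    apply: (@continuousM R _ (fun=> N) (fun q : R * 'rV[R]_n => dotp q.2 q.2)).
      exact: cst_continuous.
    apply: (@continuous_comp _ _ _ (@snd R 'rV[R]_n) (fun x => dotp x x)).
      exact: cvg_snd.
    exact: continuous_dotp.
  - apply: (@cvg_within_filter _ _ _ (nbhs q)).
    apply: (@continuousM R _ (fun=> lam) (fun q : R * 'rV[R]_n => q.1 - a)).
      exact: cst_continuous.
    by apply: cvgB; [exact: cvg_fst|exact: cvg_cst].
have B0 : B 0 by rewrite /B /= normr0 ltW.
have [[bb xb] /set_mem[/= -> Bxb] bmax] : exists2 q, q \in [set b] `*` B &
    forall q', q' \in [set b] `*` B -> G q' <= G q.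
  apply: compact_EVT_max.
  - by exists (b, 0).
  - by apply: compact_setX => //; exact: compact_set1.
  - apply: continuous_subspaceW cG => -[t x] /= [-> Bx]; split => //=.
    by rewrite in_itv/= lexx ltW.
have {}bmax x : `|x| <= rho -> G (b, x) <= G (b, xb).
  by move=> xr; apply: bmax; rewrite inE.
have [[tm xm] _ Gmax] : exists2 q, q \in Q & forall q', q' \in Q -> G q' <= G q.
  apply: compact_EVT_max => //.
  by exists (a, 0); split => //=; rewrite in_itv/= lexx ltW.
set Gm := G (tm, xm) in Gmax.
have Qa : Q (a, xa) by split => //=; rewrite in_itv/= lexx ltW.
have gap : G (b, xb) < G (a, xa).
  by rewrite /G /= subrr mulr0 addr0 drop.
have gap0 : 0 < G (a, xa) - G (b, xb) by rewrite subr_gt0.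
have [d d0 dP] := compact_unif_cont cQ cG gap0.
(* By continuity the gap survives at a time [c0] slightly after [a]. *)
pose c0 := a + Num.min (d / 2) ((b - a) / 2).
have /andP[ac0 c0b] : a < c0 < b.
  rewrite /c0 ltrDl lt_min !divr_gt0 ?subr_gt0//= -ltrBrDl.
  by rewrite gt_min; apply/orP; right; lra.
have Qc0 : Q (c0, xa) by split => //=; rewrite in_itv/= !ltW.
have Gc0 : G (b, xb) < G (c0, xa).
  have /dP : Q (a, xa) by [].
  move=> /(_ _ Qc0)/= H.
  have : ball (a, xa) d (c0, xa).
    split => /=; last exact: ballxx.
    rewrite /ball/= /c0 opprD addNKr normrN gtr0_norm.
      by rewrite gt_min; apply/orP; left; lra.
    by rewrite lt_min !divr_gt0// subr_gt0.
  by move=> /H /(le_lt_trans (ler_norm _)); rewrite ltrD2l ltrN2.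
(* The subtracted term [K * max (c0 - t, 0)^2] is nonincreasing in [t], so
   that it only lowers the supergradient; it vanishes from [c0] on, and [K]
   makes it large enough at [t = a] to push the maximum away from [a]. *)
pose K := (`|Gm - G (b, xb)| + 1) / (c0 - a) ^+ 2.
have c0a : 0 < c0 - a by rewrite subr_gt0.
have K0 : 0 < K by rewrite divr_gt0 ?exprn_gt0// ltr_wpDl.
pose m t := Num.max (c0 - t) 0.
pose Psi (q : R * 'rV[R]_n) := G q - K * m q.1 ^+ 2.
have cPsi : {within Q, continuous Psi}.
  apply/subspace_continuousP => q Qq; apply: cvgB.
    exact: (subspace_continuousP _ _).1 cG _ Qq.
  apply: (@cvg_within_filter _ _ _ (nbhs q)).
  apply: (@continuousM R _ (fun=> K) (fun q : R * 'rV[R]_n => m q.1 ^+ 2)).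
    exact: cst_continuous.
  apply: (@continuous_comp _ _ _ (@fst R 'rV[R]_n) (fun t => m t ^+ 2)).
    exact: cvg_fst.
  apply: (@continuous_comp _ _ _ m (fun y : R => y ^+ 2)).
    apply: (@continuous_max _ _ (fun t => c0 - t) (fun=> 0)).
      by apply: cvgB; [exact: cvg_cst|exact: cvg_id].
    exact: cst_continuous.
  exact: exprn_continuous.
have [[t0 x0] /set_mem Qq0 Psimax] :
    exists2 q, q \in Q & forall q', q' \in Q -> Psi q' <= Psi q.
  by apply: compact_EVT_max => //; exists (a, xa).
have {}Psimax t x : a <= t <= b -> `|x| <= rho -> Psi (t, x) <= Psi (t0, x0).
  by move=> tab xr; apply: Psimax; rewrite inE; split => //=; rewrite in_itv.
have [/= t0ab x0r] := Qq0; rewrite in_itv/= in t0ab; rewrite /B/= in x0r.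
have /andP[at0 t0b] := t0ab.
have Psi0 : G (b, xb) < Psi (t0, x0).
  apply: (lt_le_trans Gc0); apply: le_trans (Psimax c0 xa _ xar).
    by rewrite /Psi /m /= subrr max_l// expr0n/= mulr0 subr0.
  by rewrite !ltW.
have {}t0b : t0 < b.
  rewrite lt_neqAle t0b andbT; apply/eqP => t0E.
  move: Psi0; rewrite ltNge => /negP; apply.
  have mb : m b = 0 by rewrite /m max_r// subr_le0 ltW.
  rewrite /Psi /= t0E mb expr0n/= mulr0 subr0.
  exact: bmax.
have {}at0 : a < t0.
  rewrite lt_neqAle at0 andbT; apply/eqP => t0E.
  move: Psi0; rewrite ltNge => /negP; apply.
  have ma : m a = c0 - a by rewrite /m max_l// ltW.
  rewrite /Psi /= -t0E ma /K divfK ?gt_eqF ?exprn_gt0//.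
  have := Gmax (a, x0); rewrite t0E inE => /(_ Qq0).
  have := ler_norm (Gm - G (b, xb)); lra.
have Nx0 : N * `|x0| ^+ 2 <= eta.
  have := Psimax t0 0 t0ab; rewrite normr0 => /(_ (ltW rho0)).
  rewrite /Psi /G /= addr0 dotp0l.
  have := osc t0 x0 t0ab x0r.
  have : N * `|x0| ^+ 2 <= N * dotp x0 x0.
    by rewrite ler_pM2l// sqr_norm_le_dotp.
  lra.
have x0rho : `|x0| < rho.
  rewrite -(ltr_pXn2r (n := 2))// ?nnegrE// ?ltW//.
  by rewrite -(ltr_pM2l N0); exact: le_lt_trans etaN.
(* [alpha] is the partial derivative in time, at the touching point, of the
   function touching [Phi] from above. *)
exists t0, x0, (- (2 * N) * dotp x0 c - lam - 2 * K * m t0).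
have m0 t : 0 <= m t by rewrite /m le_max lexx orbT.
split => //; first by rewrite at0.
  pose C := N * (n%:R * (2 * (1 + `|c| ^+ 2))) + K.
  have c10 : 0 < 1 + `|c| by rewrite ltr_wpDr.
  pose r0 := Num.min (Num.min (t0 - a) (b - t0)) ((rho - `|x0|) / (1 + `|c|)).
  apply: (@touching_supergradient _ _ Phi t0 _ _ _ C r0).
  - by rewrite !lt_min !subr_gt0 at0 t0b divr_gt0// subr_gt0.
  - apply: addr_ge0; last exact: ltW.
    by apply: mulr_ge0; [exact: ltW|rewrite !mulr_ge0// addr_ge0// sqr_ge0].
  - move=> t X _; rewrite !lt_min -!andbA => /and3P[t1 t2 t3] /and3P[_ _ X3].
    have tab : a <= t <= b.
      move: t1 t2; rewrite !ltr_norml; lra.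
    (* [h] is the increment of the offset [X - p t] from the segment. *)
    pose h := (X - (p t0 + x0)) - (t - t0) *: c.
    have Xh : X = p t + (x0 + h).
      by apply/rowP => i; rewrite /h /p !mxE; ring.
    have hle : `|h| <= `|X - (p t0 + x0)| + `|t - t0| * `|c|.
      by rewrite (le_trans (ler_normB _ _))// normrZ.
    have xhr : `|x0 + h| <= rho.
      have : `|X - (p t0 + x0)| + `|t - t0| * `|c| <= rho - `|x0|.
        have eE : (rho - `|x0|) / (1 + `|c|) * (1 + `|c|) = rho - `|x0|.
          by rewrite divfK// gt_eqF.
        rewrite -[leRHS]eE mulrDr mulr1.
        by rewrite lerD// ?ler_wpM2r// ltW.
      have := ler_normD x0 h; lra.
    have := Psimax t (x0 + h) tab xhr.
    rewrite /Psi /G /= -Xh.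
    have mt : m t ^+ 2 <= m t0 ^+ 2 - 2 * m t0 * (t - t0) + (t - t0) ^+ 2.
      have := sqr_posp_le (c0 - t0) (t - t0).
      by rewrite /m; have -> : c0 - t0 - (t - t0) = c0 - t by ring.
    have dh : dotp (x0 + h) (x0 + h) = dotp x0 x0 + 2 * dotp x0 h + dotp h h.
      exact: dotp_sqrD.
    have hh : dotp h h <= n%:R * (2 * (1 + `|c| ^+ 2)) *
        ((t - t0) ^+ 2 + `|X - (p t0 + x0)| ^+ 2).
      apply: (le_trans (ler_norm _)); apply: (le_trans (normr_dotp _ _)).
      rewrite -mulrA ler_wpM2l// -expr2 -(real_normK (num_real (t - t0))).
      apply: (@le_trans _ _ ((`|X - (p t0 + x0)| + `|t - t0| * `|c|) ^+ 2)).
        by rewrite ler_pXn2r ?nnegrE ?addr_ge0 ?mulr_ge0.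
      set A := `|X - _|; set T := `|t - t0|; set c1 := `|c|.
      rewrite -subr_ge0.
      have -> : 2 * (1 + c1 ^+ 2) * (T ^+ 2 + A ^+ 2) - (A + T * c1) ^+ 2 =
        (A - T * c1) ^+ 2 + 2 * (T ^+ 2 + (c1 * A) ^+ 2) by ring.
      have := sqr_ge0 (A - T * c1); have := sqr_ge0 T.
      have := sqr_ge0 (c1 * A); lra.
    have -> : dotp ((2 * N) *: x0) (X - (p t0 + x0)) =
        2 * N * dotp x0 h + 2 * N * dotp x0 c * (t - t0).
      have -> : X - (p t0 + x0) = h + (t - t0) *: c by rewrite /h subrK.
      by rewrite dotpZl dotpDr dotpZr; ring.
    have KA := mulr_ge0 (ltW K0) (sqr_ge0 (`|X - (p t0 + x0)|)).
    have Kmt := ler_wpM2l (ltW K0) mt.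
    have Nhh := ler_wpM2l (ltW N0) hh.
    rewrite dh /C.
    move: KA Kmt Nhh; move: (n%:R * _) (`|X - _| ^+ 2) => S A.
    lra.
rewrite dotpZl.
have := mulr_ge0 (ltW K0) (m0 t0); lra.
Qed.
End mean_value.

(** * Integration lemmas *)

Section integral.

Lemma sub_ae d (T : measurableType d) (R : realType)
    (mu : {measure set T -> \bar R}) (P Q : T -> Prop) :
  (forall x, P x -> Q x) -> {ae mu, forall x, P x} -> {ae mu, forall x, Q x}.
Proof.
by move=> PQ; apply: filterS PQ; exact: (ae_filter_ringOfSetsType mu).
Qed.

Lemma ae_le_Rintegral d (T : measurableType d) (R : realType)
    (mu : {measure set T -> \bar R}) (D : set T) (f1 f2 : T -> R) :
  measurable D ->
  mu.-integrable D (EFin \o f1) -> mu.-integrable D (EFin \o f2) ->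
  {ae mu, forall x, D x -> f1 x <= f2 x} ->
  \int[mu]_(x in D) f1 x <= \int[mu]_(x in D) f2 x.
Proof.
move=> mD if1 if2 [N [mN N0 subN]].
rewrite /Rintegral !(negligible_integral mN mD _ N0)//.
have mDN : measurable (D `\` N) by exact: measurableD.
have iDN f : mu.-integrable D (EFin \o f) ->
    mu.-integrable (D `\` N) (EFin \o f).
  by apply: integrableS => //; exact: subDsetl.
apply: le_Rintegral => //; [exact: iDN|exact: iDN|].
by move=> x [Dx Nx]; apply: contrapT => f12; apply/Nx/subN => /= /(_ Dx).
Qed.

Lemma ae_le_integrable d (T : measurableType d) (R : realType)
    (mu : {measure set T -> \bar R}) (D : set T) (f g : T -> R) :
  measurable D -> measurable_fun D f -> mu.-integrable D (EFin \o g) ->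
  {ae mu, forall x, D x -> `|f x| <= g x} -> mu.-integrable D (EFin \o f).
Proof.
move=> mD mf ig [N [mN N0 subN]].
apply/(negligible_integrable mN mD _ N0); first exact/measurable_EFinP.
have mDN : measurable (D `\` N) by exact: measurableD.
apply: (@le_integrable _ _ _ mu _ mDN _ (EFin \o g)).
- by apply/measurable_EFinP; apply: measurable_funS mf => //; exact: subDsetl.
- move=> x [Dx Nx]; rewrite /= lee_fin.
  apply: le_trans (ler_norm _).
  by apply: contrapT => fg; apply/Nx/subN => /= /(_ Dx).
- by apply: integrableS ig => //; exact: subDsetl.
Qed.

Lemma integrableD_EFin d (T : measurableType d) (R : realType)
    (mu : {measure set T -> \bar R}) (D : set T) (f g : T -> R) :
  measurable D -> mu.-integrable D (EFin \o f) ->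
  mu.-integrable D (EFin \o g) ->
  mu.-integrable D (EFin \o (fun x => f x + g x)).
Proof. by move=> mD fi gi; exact: (integrableD mD fi gi). Qed.

Lemma integrableZl_EFin d (T : measurableType d) (R : realType)
    (mu : {measure set T -> \bar R}) (D : set T) (k : R) (f : T -> R) :
  measurable D -> mu.-integrable D (EFin \o f) ->
  mu.-integrable D (EFin \o (fun x => k * f x)).
Proof. by move=> mD fi; exact: (integrableZl mD k fi). Qed.

Context {R : realType} {n : nat}.
Notation mu := (@lebesgue_measure R).

Lemma Rintegral_itvoc_cst (a b k : R) : a <= b ->
  mu.-integrable `]a, b] (EFin \o (fun=> k)) /\
  \int[mu]_(t in `]a, b]) k = k * (b - a).
Proof.
move=> ab; have mab : (mu `]a, b] = (b - a)%:E)%E.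
  rewrite lebesgue_measure_itv/= lte_fin; case: ltP => [_|ba].
    by rewrite EFinB.
  by rewrite (@le_anti _ _ a b) ?ab// subrr.
split.
  apply: (@measurable_bounded_integrable _ _ _ mu (fun=> k)) => //.
    by rewrite [ltLHS]mab ltry.
  exists `|k|; split; first exact: num_real.
  by move=> M kM t _; exact: ltW.
by rewrite Rintegral_cst// [X in fine X]mab.
Qed.

Lemma Rintegral_dotp (D : set R) (xi : 'rV[R]_n) (g : R -> 'rV[R]_n) :
  measurable D -> vintegrable D g ->
  mu.-integrable D (EFin \o (fun t => dotp xi (g t))) /\
  \int[mu]_(t in D) dotp xi (g t) = dotp xi (vintegral D g).
Proof.
move=> mD ig.
have E t : (dotp xi (g t))%:E =
    (\sum_(i < n) ((xi ord0 i)%:E * (g t ord0 i)%:E))%E.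
  by rewrite /dotp -sumEFin; apply: eq_bigr => i _.
have ii i : mu.-integrable D (fun t => (xi ord0 i)%:E * (g t ord0 i)%:E)%E.
  exact: integrableZl.
split.
  rewrite (_ : _ \o _ = fun t => (dotp xi (g t))%:E)//.
  under eq_fun do rewrite E.
  exact: integrable_sum.
rewrite /Rintegral; under eq_integral do rewrite E.
rewrite integral_sum//.
under eq_bigr do rewrite integralZl//.
rewrite -[RHS]/(fine (EFin (dotp _ _))); congr fine.
rewrite /dotp -sumEFin; apply: eq_bigr => i _.
by rewrite mxE EFinM /Rintegral fineK//; exact: integrable_fin_num.
Qed.

Lemma Rintegral_itv_chasles (a b c : R) (g : R -> R) :
  a <= b -> b <= c -> mu.-integrable `[a, c] (EFin \o g) ->
  \int[mu]_(t in `[a, c]) g t =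
  \int[mu]_(t in `[a, b]) g t + \int[mu]_(t in `]b, c]) g t.
Proof.
move=> ab bc ig; apply/eqP; rewrite addrC -subr_eq; apply/eqP.
by rewrite Rintegral_itvB ?bnd_simp.
Qed.

Lemma vintegral_itvB (a b c : R) (g : R -> 'rV[R]_n) :
  a <= b -> b <= c -> vintegrable `[a, c] g ->
  vintegral `[a, c] g - vintegral `[a, b] g = vintegral `]b, c] g.
Proof.
move=> ab bc ig; apply/rowP => i; rewrite !mxE.
by rewrite Rintegral_itvB ?bnd_simp//; exact: ig.
Qed.

Lemma vintegral_itv_le (g : R -> 'rV[R]_n) (a b M : R) : a <= b -> 0 <= M ->
  vintegrable `]a, b] g ->
  {ae mu, forall t, `]a, b]%classic t -> `|g t| <= M} ->
  `|vintegral `]a, b] g| <= M * (b - a).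
Proof.
move=> ab M0 ig gM; apply: norm_le_coord => [|i].
  by rewrite mulr_ge0// subr_ge0.
have [iM IM] := Rintegral_itvoc_cst M ab.
have [iN IN] := Rintegral_itvoc_cst (- M) ab.
have gi : {ae mu, forall t, `]a, b]%classic t -> - M <= g t ord0 i <= M}.
  move: gM; apply: sub_ae.
  move=> t tM /tM; rewrite -ler_norml; apply: le_trans; exact: coord_le_norm.
rewrite mxE ler_norml -mulNr -IM -IN; apply/andP; split.
  apply: ae_le_Rintegral iN (ig i) _; first exact: measurable_itv.
  move: gi; apply: sub_ae.
  by move=> t tM /tM /andP[].
apply: ae_le_Rintegral (ig i) iM _; first exact: measurable_itv.
move: gi; apply: sub_ae.
by move=> t tM /tM /andP[].
Qed.

End integral.

(** * Monotonicity along a trajectory on a short interval *)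

Section step.
Context {R : realType} {n m : nat}.
Notation mu := (@lebesgue_measure R).
Implicit Types (Phi : R -> 'rV[R]_n -> R).

Lemma integrate_hamiltonian_ineq (a b alpha err : R) (xi : 'rV[R]_n)
    (g : R -> 'rV[R]_n) (lr : R -> R) :
  a <= b -> vintegrable `]a, b] g -> mu.-integrable `]a, b] (EFin \o lr) ->
  {ae mu, forall r, `]a, b]%classic r ->
    - err <= alpha + dotp xi (g r) + lr r} ->
  - (err * (b - a)) <= alpha * (b - a) + dotp xi (vintegral `]a, b] g)
                       + \int[mu]_(r in `]a, b]) lr r.
Proof.
move=> ab ig il H.
have [ie ie'] := Rintegral_itvoc_cst (- err) ab.
have [ia ia'] := Rintegral_itvoc_cst alpha ab.
have [id' id] := Rintegral_dotp xi (measurable_itv _) ig.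
have ia1 : mu.-integrable `]a, b] (EFin \o (fun r => alpha + dotp xi (g r))).
  exact: integrableD_EFin.
have ia2 : mu.-integrable `]a, b]
    (EFin \o (fun r => alpha + dotp xi (g r) + lr r)).
  exact: integrableD_EFin.
have := ae_le_Rintegral _ ie ia2 H => /(_ (measurable_itv _)).
rewrite RintegralD// RintegralD// id ie' ia'; lra.
Qed.

(** The quantity that is propagated is the existence of a point [x] of the ball
    at which [Phi t (y t + x) - N * |x|^2] is large.  [D] bounds the
    displacement of [y] on the interval and [omega] the variation in time of
    the data; the smallness condition on [eps] collects the three errors made
    when the Hamiltonian inequality at the touching point is moved to
    [(r, y r)]: [N * |x0|^2 <= eta] controls the product of the supergradient
    [2 N x0] with the Lipschitz error [K * |x0|], [K * rho] the Lipschitz error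
    of the cost, and the last term everything that vanishes with the length of
    the interval once [N] and [rho] are fixed. *)
Lemma trajectory_step Phi (f : R -> 'rV[R]_n -> 'rV[R]_m -> 'rV[R]_n)
    (L : R -> 'rV[R]_n -> 'rV[R]_m -> R) (Omega : set 'rV[R]_m)
    (y : R -> 'rV[R]_n) (w : R -> 'rV[R]_m)
    (a b rho eta N eps K D omega B : R) (xa : 'rV[R]_n) :
  0 <= a -> a < b -> 0 < N -> 0 < rho -> eta < N * rho ^+ 2 ->
  0 <= K -> D <= 1 -> 0 <= omega ->
  2 * n%:R * K * eta + K * rho + (2 * n%:R * N * rho + 1) * (2 * K * D + omega)
    < eps ->
  {within [set q : R * 'rV[R]_n | 0 <= q.1],
    continuous (fun q => Phi q.1 q.2)} ->
  (forall t (X X' : 'rV[R]_n), a <= t <= b -> `|X| <= B + 1 ->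
    `|X' - X| <= rho -> Phi t X' <= Phi t X + eta) ->
  (forall t X alpha xi, a <= t <= b ->
    dini_supergradient Phi t X (alpha, xi) ->
    forall u, Omega u -> 0 <= alpha + dotp xi (f t X u) + L t X u) ->
  (forall t, a <= t <= b -> `|y t| <= B) ->
  (forall t r, a <= t <= b -> a <= r <= b -> `|y t - y r| <= D) ->
  (forall t r X u, a <= t <= b -> a <= r <= b -> Omega u ->
    `|f t X u - f r (y r) u| <= K * `|X - y r| + omega) ->
  (forall t r X u, a <= t <= b -> a <= r <= b -> Omega u ->
    `|L t X u - L r (y r) u| <= K * `|X - y r| + omega) ->
  {ae mu, forall r, a <= r -> Omega (w r)} ->
  vintegrable `]a, b] (fun r => f r (y r) (w r)) ->
  y b - y a = vintegral `]a, b] (fun r => f r (y r) (w r)) ->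
  mu.-integrable `]a, b] (EFin \o (fun r => L r (y r) (w r))) ->
  `|xa| <= rho ->
  exists2 xb : 'rV[R]_n, `|xb| <= rho &
    Phi a (y a + xa) - N * dotp xa xa <=
    Phi b (y b + xb) - N * dotp xb xb
      + \int[mu]_(r in `]a, b]) L r (y r) (w r) + eps * (b - a).
Proof.
move=> a0 ab N0 rho0 etaN K0 D1 omega0 smalleps cPhi osc ham yB yD fr Lr wO.
move=> ig yE il xar.
apply: contrapT => noxb.
have ba0 : 0 < b - a by rewrite subr_gt0.
pose c := (b - a)^-1 *: (y b - y a).
have cE : (b - a) *: c = y b - y a.
  by rewrite scalerA divff ?scale1r// gt_eqF.
pose I := \int[mu]_(r in `]a, b]) L r (y r) (w r).
(* [lam] is the mean running cost plus the tolerance [eps]; the mean value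
   lemma then contradicts the integrated Hamiltonian inequality. *)
pose lam := I / (b - a) + eps.
have lamE : lam * (b - a) = I + eps * (b - a).
  by rewrite mulrDl divfK// gt_eqF.
have aab : a <= a <= b by rewrite lexx ltW.
have bab : a <= b <= b by rewrite lexx ltW.
have pD t : a <= t <= b -> `|(t - a) *: c| <= D.
  move=> /andP[t1 t2]; rewrite /c scalerA normrZ.
  apply: le_trans (yD b a bab aab).
  rewrite ler_piMl// ger0_norm ?mulr_ge0 ?invr_ge0 ?subr_ge0//; last exact: ltW.
  by rewrite ler_pdivrMr// mul1r lerD2r.
have [||t0 [x0 [alpha [t0ab x0r Nx0 supg alpha_le]]]] := @viscosity_mean_value
    _ n Phi a b (y a) c lam N rho eta xa a0 ab N0 rho0 etaN cPhi _ xar.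
- move=> t x tab xr; apply: osc => //; last by rewrite addrC addKr.
  by rewrite (le_trans (ler_normD _ _))// lerD ?yB// (le_trans (pD _ _)).
- move=> xb xbr; rewrite ltNge; apply/negP => H; apply: noxb; exists xb => //.
  move: H; rewrite subrr scale0r addr0 cE lamE addrA.
  have -> : y a + (y b - y a) = y b by rewrite addrC subrK.
  done.
pose p t : 'rV[R]_n := y a + (t - a) *: c.
have {}t0ab : a <= t0 <= b by case/andP: t0ab => *; rewrite !ltW.
pose s := 2 * K * D + omega.
pose err := 2 * N * n%:R * `|x0| * (K * `|x0| + s) + (K * `|x0| + s).
have D0 : 0 <= D by apply: le_trans (yD a a aab aab).
have Xy r : a <= r <= b -> `|p t0 + x0 - y r| <= `|x0| + 2 * D.
  move=> rab; have -> : p t0 + x0 - y r = x0 + ((y a - y r) + (t0 - a) *: c).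
    by apply/rowP => i; rewrite /p !mxE; ring.
  rewrite (le_trans (ler_normD _ _))// lerD2l (le_trans (ler_normD _ _))//.
  by rewrite mulrDl mul1r lerD ?pD ?yD.
have := @integrate_hamiltonian_ineq a b alpha err ((2 * N) *: x0) _ _
  (ltW ab) ig il.
rewrite -yE -cE dotpZr -/I.
have aeH : {ae mu, forall r, `]a, b]%classic r ->
    - err <= alpha + dotp ((2 * N) *: x0) (f r (y r) (w r)) + L r (y r) (w r)}.
  move: wO; apply: sub_ae.
  move=> r wO /=; rewrite in_itv/= => /andP[/ltW ar rb].
  have rab : a <= r <= b by rewrite ar.
  have := ham _ _ _ _ t0ab supg _ (wO ar).
  have Ks : K * `|p t0 + x0 - y r| + omega <= K * `|x0| + s.
    by rewrite /s addrA lerD2r (mulrC 2) -mulrA -mulrDr ler_wpM2l// Xy.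
  have /le_trans/(_ Ks) dL := Lr t0 r (p t0 + x0) (w r) t0ab rab (wO ar).
  have /le_trans/(_ Ks) df := fr t0 r (p t0 + x0) (w r) t0ab rab (wO ar).
  have := ler_normlP _ _ dL => -[_ dL'].
  rewrite -/(p t0); set F := f t0 _ _ in df *; set F' := f r _ _ in df *.
  have dotF : dotp ((2 * N) *: x0) F - dotp ((2 * N) *: x0) F' =
      2 * N * dotp x0 (F - F').
    by rewrite !dotpZl dotpDr -(scaleN1r F') dotpZr; ring.
  have dotn : dotp x0 (F - F') <= n%:R * (`|x0| * (K * `|x0| + s)).
    rewrite (le_trans (ler_norm _))// (le_trans (normr_dotp _ _))//.
    by rewrite ler_wpM2l// ler_wpM2l.
  have {}dotn := ler_wpM2l (mulr_ge0 (ler0n _ 2) (ltW N0)) dotn.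
  rewrite /err; lra.
move=> /(_ aeH).
have errle : err < eps.
  apply: le_lt_trans smalleps; rewrite -/s /err.
  have s0 : 0 <= s by rewrite addr_ge0// !mulr_ge0.
  have h1 : 2 * n%:R * K * (N * `|x0| ^+ 2) <= 2 * n%:R * K * eta.
    by rewrite ler_wpM2l// !mulr_ge0.
  have h2 : K * `|x0| <= K * rho by rewrite ler_wpM2l.
  have h3 : 2 * n%:R * N * s * `|x0| <= 2 * n%:R * N * s * rho.
    by rewrite ler_wpM2l// !mulr_ge0// ltW.
  lra.
have := ler_wpM2r (ltW ba0) alpha_le.
rewrite mul0r mulrDl lamE dotpZl => hneg.
have : err * (b - a) < eps * (b - a) by rewrite ltr_pM2r.
move: hneg; lra.
Qed.
End step.

(** * Monotonicity on a finite horizon *)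

Section finite_horizon.
Context {R : realType} {n m : nat}.
Notation mu := (@lebesgue_measure R).
Implicit Types (Phi : R -> 'rV[R]_n -> R).

Lemma time_modulus (Y : normedModType R) (g : R -> 'rV[R]_n -> 'rV[R]_m -> Y)
    (Omega : set 'rV[R]_m) (T B e : R) :
  compact Omega ->
  {within [set p : R * 'rV[R]_n * 'rV[R]_m | 0 <= p.1.1],
     continuous (fun p => g p.1.1 p.1.2 p.2)} ->
  0 < e -> exists2 d, 0 < d & forall t r X u, 0 <= t <= T -> 0 <= r <= T ->
    `|X| <= B -> Omega u -> `|t - r| < d -> `|g t X u - g r X u| < e.
Proof.
move=> cO cg e0.
pose Q := (`[0, T] `*` [set x : 'rV[R]_n | `|x| <= B]) `*` Omega.
have cQ : compact Q.
  apply: compact_setX => //; apply: compact_setX; first exact: segment_compact.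
  exact: compact_norm_le.
have cgQ : {within Q, continuous (fun p => g p.1.1 p.1.2 p.2)}.
  apply: continuous_subspaceW cg => -[[t X] u] [[/= + _] _].
  by rewrite in_itv/= => /andP[].
have [d d0 dP] := compact_unif_cont cQ cgQ e0.
exists d => // t r X u t0T r0T XB Ou tr.
apply: (dP (t, X, u) (r, X, u)) => //.
by split; [split; [exact: tr|exact: ballxx]|exact: ballxx].
Qed.

Lemma space_modulus Phi (T B e : R) :
  {within [set q : R * 'rV[R]_n | 0 <= q.1],
    continuous (fun q => Phi q.1 q.2)} ->
  0 < e -> exists2 d, 0 < d & forall t X X', 0 <= t <= T ->
    `|X| <= B -> `|X'| <= B -> `|X - X'| < d -> `|Phi t X - Phi t X'| < e.
Proof.
move=> cPhi e0.
pose Q := `[0, T] `*` [set x : 'rV[R]_n | `|x| <= B].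
have cQ : compact Q.
  by apply: compact_setX; [exact: segment_compact|exact: compact_norm_le].
have cgQ : {within Q, continuous (fun p => Phi p.1 p.2)}.
  apply: continuous_subspaceW cPhi => -[t X] [/= + _].
  by rewrite in_itv/= => /andP[].
have [d d0 dP] := compact_unif_cont cQ cgQ e0.
exists d => // t X X' t0T XB X'B XX'.
apply: (dP (t, X) (t, X')) => //; split => //=; first exact: ballxx.
by rewrite -ball_normE.
Qed.

Lemma fine_chaining (P : R -> Prop) (s T h0 : R) :
  s <= T -> 0 < h0 -> P s ->
  (forall a b, s <= a -> a < b -> b <= T -> b - a < h0 -> P a -> P b) -> P T.
Proof.
rewrite le_eqVlt => /predU1P[<-//|sT] h00 Ps step.
have Ts0 : 0 < T - s by rewrite subr_gt0.
have [k kP] : exists k : nat, (T - s) / h0 < k%:R.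
  exists (Num.bound ((T - s) / h0)).
  by apply: archi_boundP; rewrite divr_ge0// ltW.
have k0 : 0 < k%:R :> R by apply: le_lt_trans kP; rewrite divr_ge0// ltW.
pose h := (T - s) / k%:R.
have h_gt0 : 0 < h by rewrite divr_gt0.
have hh0 : h < h0 by rewrite ltr_pdivrMr// mulrC -ltr_pdivrMr.
pose a (i : nat) : R := s + i%:R * h.
have aS i : a i.+1 = a i + h by rewrite /a -natr1 mulrDl mul1r addrA.
have akT : a k = T by rewrite /a /h mulrC divfK ?gt_eqF// addrC subrK.
have a_le i : (i <= k)%N -> a i <= T.
  by move=> ik; rewrite -akT /a lerD2l ler_wpM2r ?ler_nat// ltW.
suff chain i : (i <= k)%N -> P (a i) by rewrite -akT; exact: chain.
elim: i => [_|i IH ik]; first by rewrite /a mul0r addr0.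
apply: (step (a i)) (IH (ltnW ik)); rewrite ?a_le//.
- by rewrite lerDl mulr_ge0// ltW.
- by rewrite aS ltrDl.
- by rewrite aS addrC addKr.
Qed.

(** The order of the choices matters: [eta] depends on the dimension [nn], the
    Lipschitz constant [K] and the tolerance [e] only, [rho] on the modulus [d]
    of [Phi] for [eta], the penalty [N] on [eta] and [rho], and the bounds [D]
    and [omega] on the displacement and on the variation of the data come
    last.  Each of the four error terms is made at most [e / 4], the first one
    strictly. *)
Lemma penalty_parameters (nn K e : R) : 0 <= nn -> 0 <= K -> 0 < e ->
  exists eta, [/\ 0 < eta, eta <= e & forall d, 0 < d ->
  exists rho N D omega, [/\ 0 < rho <= 1, rho < d, 0 < N, eta < N * rho ^+ 2 &
  [/\ 0 < D <= 1, 0 < omega &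
  2 * nn * K * eta + K * rho + (2 * nn * N * rho + 1) * (2 * K * D + omega)
    < e]]].
Proof.
move=> nn0 K0 e0; have nnK : 0 <= nn * K by rewrite mulr_ge0.
have den0 : 0 < 8 * (nn * K + 1) by lra.
have K1 : 0 < 4 * (K + 1) by lra.
exists (e / (8 * (nn * K + 1))).
have : 0 < e / (8 * (nn * K + 1)) by rewrite divr_gt0.
have : e / (8 * (nn * K + 1)) * (8 * (nn * K + 1)) = e.
  by rewrite divfK// gt_eqF.
move: (e / _) => eta etaE eta0.
have etanK : 0 <= eta * (nn * K) by rewrite mulr_ge0// ltW.
split => //; first by lra.
move=> d d0.
pose rho := Num.min (d / 2) (Num.min 1 (e / (4 * (K + 1)))).
have rho0 : 0 < rho by rewrite !lt_min ltr01 !divr_gt0.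
have rhod : rho < d by rewrite gt_min; apply/orP; left; lra.
have rho1 : rho <= 1 by rewrite !ge_min lexx orbT.
have Krho : K * rho <= e / 4.
  have : rho <= e / (4 * (K + 1)) by rewrite !ge_min lexx !orbT.
  rewrite ler_pdivlMr// => H; lra.
move: rho rho0 rhod rho1 Krho => rho rho0 rhod rho1 Krho.
have rho20 : 0 < rho ^+ 2 by rewrite exprn_gt0.
pose N := eta / rho ^+ 2 + 1.
have N0 : 0 < N by rewrite ltr_wpDl// divr_ge0// ltW.
have etaN : eta < N * rho ^+ 2.
  by rewrite /N mulrDl divfK ?gt_eqF// mul1r ltrDl.
move: N N0 etaN => N N0 etaN.
have : 0 < 2 * nn * N * rho + 1.
  by rewrite ltr_wpDl// !mulr_ge0// ltW.
have [kap kapE] : exists kap, 2 * nn * N * rho + 1 = kap by eexists.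
rewrite kapE => kap0.
have Kkap0 : 0 < 16 * ((K + 1) * kap) by rewrite !mulr_gt0//; lra.
exists rho, N, (Num.min 1 (e / (16 * ((K + 1) * kap)))), (e / (8 * kap)).
split => //; first by rewrite rho0.
have D0 : 0 < Num.min 1 (e / (16 * ((K + 1) * kap))).
  by rewrite lt_min ltr01/= divr_gt0.
have : Num.min 1 (e / (16 * ((K + 1) * kap))) * (16 * ((K + 1) * kap)) <= e.
  by rewrite -ler_pdivlMr// ge_min lexx orbT.
have : Num.min 1 (e / (16 * ((K + 1) * kap))) <= 1 by rewrite ge_min lexx.
move: (Num.min _ _) D0 => D D0 D1 De; split.
- by rewrite D0.
- by rewrite divr_gt0// mulr_gt0.
- have : e / (8 * kap) * (8 * kap) = e by rewrite divfK// gt_eqF// mulr_gt0.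
  move: (e / _) => omega omegaE.
  have : 0 <= D * kap by rewrite mulr_ge0// ltW.
  rewrite kapE; lra.
Qed.

Lemma finite_horizon_bound Phi (f : R -> 'rV[R]_n -> 'rV[R]_m -> 'rV[R]_n)
    (L : R -> 'rV[R]_n -> 'rV[R]_m -> R) (Omega : set 'rV[R]_m)
    (y : R -> 'rV[R]_n) (w : R -> 'rV[R]_m) (s T K B C : R) :
  0 <= s -> s <= T -> 0 <= K -> 0 <= C -> compact Omega ->
  {within [set q : R * 'rV[R]_n | 0 <= q.1],
    continuous (fun q => Phi q.1 q.2)} ->
  {within [set p : R * 'rV[R]_n * 'rV[R]_m | 0 <= p.1.1],
     continuous (fun p => f p.1.1 p.1.2 p.2)} ->
  {within [set p : R * 'rV[R]_n * 'rV[R]_m | 0 <= p.1.1],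
     continuous (fun p => L p.1.1 p.1.2 p.2)} ->
  (forall t X X' u, 0 <= t -> Omega u ->
    `|f t X u - f t X' u| <= K * `|X - X'|) ->
  (forall t X X' u, 0 <= t -> Omega u ->
    `|L t X u - L t X' u| <= K * `|X - X'|) ->
  (forall t X alpha xi, 0 <= t -> dini_supergradient Phi t X (alpha, xi) ->
    forall u, Omega u -> 0 <= alpha + dotp xi (f t X u) + L t X u) ->
  (forall t, s <= t -> `|y t| <= B) ->
  (forall t r, s <= t -> t <= r -> `|y r - y t| <= C * (r - t)) ->
  {ae mu, forall r, s <= r -> Omega (w r)} ->
  (forall t, s <= t -> vintegrable `[s, t] (fun r => f r (y r) (w r)) /\
    y t = y s + vintegral `[s, t] (fun r => f r (y r) (w r))) ->
  mu.-integrable `[s, T] (EFin \o (fun r => L r (y r) (w r))) ->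
  Phi s (y s) <= Phi T (y T) + \int[mu]_(r in `[s, T]) L r (y r) (w r).
Proof.
move=> s0 sT K0 C0 cO cPhi cf cL Lf LL ham yB yC wO yE il.
suff main e : 0 < e -> Phi s (y s) <= Phi T (y T)
    + \int[mu]_(r in `[s, T]) L r (y r) (w r) + e * (T - s) + e.
  apply/ler_addgt0Pr => e e0.
  have e'0 : 0 < e / (T - s + 1) by rewrite divr_gt0// ltr_wpDl// subr_ge0.
  have := main _ e'0.
  rewrite -addrA -[X in _ + X](_ : e / (T - s + 1) * (T - s + 1) = _).
    2: by ring.
  by rewrite divfK// gt_eqF// ltr_wpDl// subr_ge0.
move=> e0.
have [eta [eta0 etae getp]] := penalty_parameters (ler0n R n) K0 e0.
have [d d0 dP] := @space_modulus Phi T (B + 2) eta cPhi eta0.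
have [rho [N [D [omega [/andP[rho0 rho1] rhod N0 etaN]]]]] := getp d d0.
move=> [/andP[D0 D1] omega0 smalleps].
have [df df0 dfP] := time_modulus T B cO cf omega0.
have [dl dl0 dlP] := @time_modulus R^o L Omega T B omega cO cL omega0.
have C1 : 0 < C + 1 by rewrite ltr_wpDl.
pose h0 := Num.min (D / (C + 1)) (Num.min df dl).
have h00 : 0 < h0 by rewrite !lt_min df0 dl0 divr_gt0.
(* For [x = 0] this is the claim with horizon [t], up to the tolerance. *)
pose P t := exists2 x : 'rV[R]_n, `|x| <= rho &
  Phi s (y s) <= Phi t (y t) + \int[mu]_(r in `[s, t]) L r (y r) (w r)
    + e * (t - s) + (Phi t (y t + x) - Phi t (y t)) - N * dotp x x.
suff : P T.
  move=> [x xr] /le_trans; apply; rewrite -addrA lerD2l.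
  have : `|Phi T (y T + x) - Phi T (y T)| < eta.
    have yT := yB _ sT; have := ler_normD (y T) x => yTx.
    apply: dP; rewrite ?lexx ?andbT.
    - exact: le_trans sT.
    - by clear -yT yTx xr rho1; lra.
    - by clear -yT; lra.
    - by rewrite addrC addKr; apply: le_lt_trans rhod.
  rewrite ltr_norml => /andP[_ Hphi].
  have Ndot : 0 <= N * dotp x x by rewrite mulr_ge0 ?dotp_ge0// ltW.
  by clear -Ndot Hphi etae; lra.
apply: (fine_chaining sT h00).
  exists 0; first by rewrite normr0 ltW.
  rewrite set_itv1 Rintegral_set1 dotp0l mulr0 subrr mulr0.
  by rewrite !addr0 subrr subr0 addr0.
move=> a b sa ab bT ba [x xr Hx].
have hC : C * (b - a) <= D.
  have : (b - a) * (C + 1) < D.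
    by rewrite -ltr_pdivlMr//; apply: lt_le_trans ba _; rewrite ge_min lexx.
  by clear -ab; lra.
have hdf : b - a < df by apply: lt_le_trans ba _; rewrite !ge_min lexx !orbT.
have hdl : b - a < dl by apply: lt_le_trans ba _; rewrite !ge_min lexx !orbT.
have a0 : 0 <= a by apply: le_trans sa.
have iv t : a <= t <= b -> [/\ s <= t, 0 <= t & 0 <= t <= T].
  move=> /andP[t1 t2]; have st : s <= t by apply: le_trans sa t1.
  have t0 : 0 <= t by apply: le_trans s0 st.
  by split => //; rewrite t0/= (le_trans t2).
have iv2 t r : a <= t <= b -> a <= r <= b -> `|t - r| <= b - a.
  clear; rewrite ler_norml => /andP[t1 t2] /andP[r1 r2].
  by apply/andP; split; lra.
have sb : s <= b by apply: le_trans sa (ltW ab).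
have [ig yT] := yE _ sb.
have [_ yT'] := yE _ sa.
have ilb : mu.-integrable `[s, b] (EFin \o (fun r => L r (y r) (w r))).
  by apply: integrableS il => //; apply: subset_itvl; rewrite bnd_simp.
have [|||||||||||x' x'r Hx'] := @trajectory_step R n m Phi f L Omega y w a
    b rho eta N e K D omega B x a0 ab N0 rho0 etaN K0 D1
    (ltW omega0) smalleps cPhi.
- move=> t X X' /iv[_ _ tT] XB XX'.
  have : `|Phi t X' - Phi t X| < eta.
    have XX := ler_normD (X' - X) X; rewrite subrK in XX.
    apply: dP => //; last exact: le_lt_trans rhod.
      by clear -XX XX' XB rho1; lra.
    by clear -XB; lra.
  by clear; rewrite ltr_norml => /andP[_]; lra.
- by move=> t X alpha xi /iv[_ t0 _]; exact: ham.
- by move=> t /iv[st _ _]; exact: yB.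
- move=> t r tI rI; have [st _ _] := iv _ tI; have [sr _ _] := iv _ rI.
  have Ctr : C * `|t - r| <= D.
    by apply: le_trans hC; rewrite ler_wpM2l// iv2.
  apply: le_trans Ctr; have [tr|rt] := leP t r.
    rewrite distrC (_ : `|t - r| = r - t); first exact: yC.
    by rewrite distrC ger0_norm// subr_ge0.
  rewrite (_ : `|t - r| = t - r); first by apply: yC => //; exact: ltW.
  by rewrite gtr0_norm// subr_gt0.
- move=> t r X u tI rI Ou.
  have [st t0 tT] := iv _ tI; have [sr _ rT] := iv _ rI.
  apply: (le_trans (ler_distD (f t (y r) u) _ _)); apply: lerD; first exact: Lf.
  apply/ltW/dfP => //; first exact: yB.
  by apply: le_lt_trans hdf; exact: iv2.
- move=> t r X u tI rI Ou.
  have [st t0 tT] := iv _ tI; have [sr _ rT] := iv _ rI.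
  apply: (le_trans (ler_distD (L t (y r) u) _ _)); apply: lerD; first exact: LL.
  apply/ltW/dlP => //; first exact: yB.
  by apply: le_lt_trans hdl; exact: iv2.
- move: wO; apply: sub_ae.
  by move=> r wO ar; apply: wO; exact: le_trans ar.
- move=> j; apply: integrableS (ig j) => //.
  by apply: subset_itvr; rewrite bnd_simp.
- by rewrite yT yT' opprD addrACA subrr add0r vintegral_itvB//; exact: ltW.
- apply: integrableS ilb => //.
  by apply: subset_itvr; rewrite bnd_simp.
- exact: xr.
exists x' => //.
rewrite (Rintegral_itv_chasles sa (ltW ab) ilb).
by clear -Hx Hx'; lra.
Qed.
End finite_horizon.

(** * The discounted cost on the infinite horizon *)

Section discount.
Context {R : realType}.
Notation mu := (@lebesgue_measure R).
Context (delta : R) (delta0 : 0 < delta).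

Lemma cvg_expR_discount : expR (- delta * t) @[t --> +oo] --> (0 : R).
Proof.
rewrite (_ : (fun t => _) = (fun z => expR (- z)) \o (fun t => delta * t)).
  apply: (@cvg_comp _ _ _ _ _ _ (pinfty_nbhs R)); last exact: cvgr_expR.
  by apply: gt0_cvgMry => //; exact: cvg_id.
by apply: eq_fun => t; rewrite mulNr.
Qed.

Lemma continuous_discount : continuous (fun t : R => expR (- delta * t)).
Proof.
move=> t; apply: continuous_comp; last exact: continuous_expR.
exact: mulrl_continuous.
Qed.

Lemma integral_discount (a : R) :
  (\int[mu]_(t in `[a, +oo[) (delta * expR (- delta * t))%:E =
   (expR (- delta * a))%:E)%E.
Proof.
rewrite (@ge0_continuous_FTC2y _ _ (fun t => - expR (- delta * t)) a 0).
- by rewrite EFinN oppeK add0e.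
- by move=> t _; rewrite mulr_ge0 ?expR_ge0// ltW.
- apply: continuous_subspaceT => t.
  apply: (@continuousM R R^o (fun=> delta) (fun t => expR (- delta * t)) t).
    exact: cst_continuous.
  exact: continuous_discount.
- by rewrite -oppr0; apply: cvgN; exact: cvg_expR_discount.
- by move=> t _; exact: ex_derive.
- by apply: cvgN; apply/cvg_at_right_filter; exact: continuous_discount.
- move=> t _.
  rewrite derive1_comp// derive1N// derive1_id mulN1r derive1_comp// derive1E.
  have /funeqP -> := @derive_expR R.
  by rewrite derive1Ml// derive1_id mulr1 mulrN opprK mulrC.
Qed.

Lemma integrable_discount (a : R) :
  mu.-integrable `[a, +oo[ (EFin \o (fun t => delta * expR (- delta * t))).
Proof.
apply/integrableP; split.
  apply/measurable_EFinP; apply: measurable_funTS; apply: measurable_funM => //.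
  by apply: measurableT_comp => //; exact: measurable_funM.
under eq_integral do rewrite /= ger0_norm ?mulr_ge0 ?expR_ge0 ?ltW//.
by rewrite integral_discount ltry.
Qed.

(** An integrand dominated by the discount loses at most [C * exp (- delta T)]
    when its domain is truncated at [T]. *)
Lemma Rintegral_discount_truncate (g : R -> R) (C s T : R) :
  s <= T -> mu.-integrable `[s, +oo[ (EFin \o g) ->
  {ae mu, forall t, s <= t -> `|g t| <= C * (delta * expR (- delta * t))} ->
  \int[mu]_(t in `[s, T]) g t <=
  \int[mu]_(t in `[s, +oo[) g t + C * expR (- delta * T).
Proof.
move=> sT ig gC.
have igT : mu.-integrable `]T, +oo[ (EFin \o g).
  by apply: integrableS ig => //; apply: subset_itvr; rewrite bnd_simp.
have idT : mu.-integrable `]T, +oo[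
    (EFin \o (fun t => delta * expR (- delta * t))).
  apply: integrableS (integrable_discount T) => //.
  by apply: subset_itvr; rewrite bnd_simp.
have idT' : mu.-integrable `]T, +oo[
    (EFin \o (fun t => - C * (delta * expR (- delta * t)))).
  by apply: integrableZl_EFin => //; exact: measurable_itv.
have tail_ge : - C * expR (- delta * T) <= \int[mu]_(t in `]T, +oo[) g t.
  have <- : \int[mu]_(t in `]T, +oo[) (delta * expR (- delta * t)) =
      expR (- delta * T).
    by rewrite Rintegral_itv_obnd_cbnd// /Rintegral integral_discount.
  rewrite -(RintegralZl _ _ idT); last exact: measurable_itv.
  apply: (ae_le_Rintegral _ idT' igT); first exact: measurable_itv.
  move: gC; apply: sub_ae => t gC; rewrite /= in_itv/= andbT => /ltW Tt.
  have := gC (le_trans sT Tt).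
  by rewrite (mulNr C) ler_norml => /andP[].
have <- : \int[mu]_(t in `[s, +oo[) g t - \int[mu]_(t in `]T, +oo[) g t =
    \int[mu]_(t in `[s, T]) g t.
  rewrite -(@Rintegral_itvB _ _ (BLeft s) +oo%O T ig) ?bnd_simp//.
  by rewrite opprB addrC subrK.
by rewrite lerD2l lerNl -(mulNr C).
Qed.

End discount.

Section infinite_horizon.
Context {R : realType} {n m : nat}.
Notation mu := (@lebesgue_measure R).

Lemma hamiltonian_ge0_ineq (l : R -> 'rV[R]_n -> 'rV[R]_m -> R)
    (f : R -> 'rV[R]_n -> 'rV[R]_m -> 'rV[R]_n) (Omega : set 'rV[R]_m)
    (delta : R) (t alpha : R) (X xi : 'rV[R]_n) (u : 'rV[R]_m) :
  (0 <= alpha%:E + hamiltonian l f Omega delta t X xi)%E -> Omega u ->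
  0 <= alpha + dotp xi (f t X u) + expR (- delta * t) * l t X u.
Proof.
move=> H Ou; rewrite -lee_fin -addrA EFinD; apply: (le_trans H).
by rewrite leeD2l//; apply: ereal_inf_lbound; exists u.
Qed.

Lemma bounded_set_norm_le (S : set 'rV[R]_n) : bounded_set S ->
  exists2 B, 0 <= B & forall x, S x -> `|x| <= B.
Proof.
move=> [M [_ MS]]; exists (`|M| + 1); first by rewrite addr_ge0.
by move=> x; apply: MS; rewrite ltr_pwDr// ler_norm.
Qed.

Lemma uniform_limit0_le (Phi : R -> 'rV[R]_n -> R) (B e : R) :
  (forall K : set 'rV[R]_n, compact K ->
        {uniform K, Phi @ +oo --> (fun _ : 'rV[R]_n => 0 : R)}) ->
  0 < e -> \forall t \near +oo, forall x : 'rV[R]_n, `|x| <= B -> Phi t x <= e.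
Proof.
move=> /(_ _ (@compact_norm_le R n B)) H e0.
have /H : nbhs ((fun _ => 0) : {uniform` [set x : 'rV[R]_n | `|x| <= B] -> R})
    [set h | forall y, `|y| <= B -> ball (0 : R) e (h y)].
  apply/uniform_nbhs; exists [set p | ball p.1 e p.2].
  by split => //; exact: (entourage_ball _ (PosNum e0)).
move=> nearPhi.
have {}nearPhi : \forall t \near +oo,
  forall y : 'rV[R]_n, `|y| <= B -> ball (0 : R) e (Phi t y) by exact: nearPhi.
apply: filterS nearPhi => t tB x xB.
have := tB x xB; rewrite -ball_normE /= sub0r normrN => /ltW.
by apply: le_trans; exact: ler_norm.
Qed.

Lemma continuous_discounted (l : R -> 'rV[R]_n -> 'rV[R]_m -> R) (delta : R) :
  {within [set p : R * 'rV[R]_n * 'rV[R]_m | 0 <= p.1.1],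
     continuous (fun p => l p.1.1 p.1.2 p.2)} ->
  {within [set p : R * 'rV[R]_n * 'rV[R]_m | 0 <= p.1.1],
     continuous (fun p => expR (- delta * p.1.1) * l p.1.1 p.1.2 p.2)}.
Proof.
move=> cl; apply/subspace_continuousP => p p0; apply: cvgM.
  apply: (@cvg_within_filter _ _ _ (nbhs p)).
  have c1 : fst (fst q) @[q --> nbhs p] --> nbhs p.1.1.
    by apply: (cvg_comp fst fst cvg_fst); exact: cvg_fst.
  apply: (cvg_comp _ (fun t => expR (- delta * t)) c1).
  exact: (@continuous_discount R delta p.1.1).
exact: (subspace_continuousP _ _).1 cl p p0.
Qed.

(** The hypotheses on the data are used to bring the process into the scope of
    the finite horizon estimate: bounded states make the velocities bounded,
    hence the trajectory Lipschitz, and make the running cost at most [M] times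
    the discount, hence integrable on the half-line. *)
Lemma subsolution_le_cost (l : R -> 'rV[R]_n -> 'rV[R]_m -> R)
    (f : R -> 'rV[R]_n -> 'rV[R]_m -> 'rV[R]_n)
    (Omega : set 'rV[R]_m) (delta : R) (Phi : R -> 'rV[R]_n -> R) (s : R)
    (z : 'rV[R]_n) (y : R -> 'rV[R]_n) (w : R -> 'rV[R]_m) :
  0 < delta -> lipschitz_data l f Omega -> linear_growth_data l f Omega ->
  continuous_data l f -> compact Omega ->
  bounded_finite_cost_states l f Omega delta ->
  dini_subsolution l f Omega delta Phi -> 0 <= s ->
  finite_cost_process l f Omega delta s z y w ->
  ((Phi s z)%:E <= cost l delta s y w)%E.
Proof.
move=> delta0 [K1 K10 Lip] [K2 K20 Gr] [cl cf] cO A6 [cPhi HJB Phi0] s0 fcp.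
have [[[_ wO] _ yE] [mcost _] _] := fcp.
have [S /bounded_set_norm_le[B B0 SB] yS] := A6 s z s0.
have {SB} yB t : s <= t -> `|y t| <= B.
  by move=> st; apply: SB; exact: yS fcp _ st.
pose L t x u := expR (- delta * t) * l t x u.
(* [c] compares the Euclidean norm of the hypotheses with the sup norm. *)
pose c : R := n.+1%:R.
have lipK t X X' u : 0 <= t -> Omega u ->
    `|l t X u - l t X' u| + `|f t X u - f t X' u| <= K1 * c * `|X - X'|.
  move=> t0 Ou; apply: le_trans (_ : _ <= K1 * enorm (X - X')) _.
    by apply: le_trans (Lip t u t0 Ou X X'); rewrite lerD2l norm_le_enorm.
  by rewrite -mulrA ler_pM2l// enorm_le_norm.
have K0 : 0 <= K1 * c by rewrite mulr_ge0// ltW.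
have lipf t X X' u : 0 <= t -> Omega u ->
    `|f t X u - f t X' u| <= K1 * c * `|X - X'|.
  by move=> t0 Ou; apply: le_trans (lipK t X X' u t0 Ou); rewrite lerDr.
have lipL t X X' u : 0 <= t -> Omega u ->
    `|L t X u - L t X' u| <= K1 * c * `|X - X'|.
  move=> t0 Ou; rewrite /L -mulrBr normrM (ger0_norm (expR_ge0 _)).
  have d1 : expR (- delta * t) <= 1.
    by rewrite -expR0 ler_expR mulNr oppr_le0 mulr_ge0// ltW.
  apply: (le_trans (ler_piMl _ d1)) => //.
  by apply: le_trans (lipK t X X' u t0 Ou); rewrite lerDl.
pose M := K2 * (1 + c * B).
have M0 : 0 <= M.
  by apply: mulr_ge0; [exact: ltW|rewrite addr_ge0// mulr_ge0].
have growM t u : s <= t -> Omega u -> `|l t (y t) u| + `|f t (y t) u| <= M.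
  move=> st Ou; apply: le_trans (_ : _ <= K2 * (1 + enorm (y t))) _.
    apply: le_trans (Gr t (y t) u (le_trans s0 st) Ou).
    by rewrite lerD2l norm_le_enorm.
  rewrite ler_pM2l// lerD2l (le_trans (enorm_le_norm _))// ler_wpM2l//.
  exact: yB.
have ys : y s = z.
  have [_ ->] := yE s (lexx s); apply/rowP => i.
  by rewrite !mxE set_itv1 Rintegral_set1 addr0.
have yE' t : s <= t -> vintegrable `[s, t] (fun r => f r (y r) (w r)) /\
    y t = y s + vintegral `[s, t] (fun r => f r (y r) (w r)).
  by rewrite ys; exact: yE.
have yM t r : s <= t -> t <= r -> `|y r - y t| <= M * (r - t).
  move=> st tr; have sr := le_trans st tr.
  have [ir ->] := yE r sr; have [_ ->] := yE t st.
  rewrite opprD addrACA subrr add0r vintegral_itvB//.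
  apply: vintegral_itv_le => //.
    move=> j; apply: integrableS (ir j) => //.
    by apply: subset_itvr; rewrite bnd_simp.
  move: wO; apply: sub_ae => q wO; rewrite /= in_itv/= => /andP[/ltW tq _].
  have sq := le_trans st tq.
  by apply: le_trans (growM q _ sq (wO sq)); rewrite lerDr.
have LM : {ae mu, forall t, s <= t ->
    `|L t (y t) (w t)| <= M / delta * (delta * expR (- delta * t))}.
  move: wO; apply: sub_ae => t wO st.
  rewrite mulrA divfK ?gt_eqF// /L normrM (ger0_norm (expR_ge0 _)).
  rewrite mulrC ler_wpM2r ?expR_ge0//.
  by apply: le_trans (growM t _ st (wO st)); rewrite lerDl.
have iL : mu.-integrable `[s, +oo[ (EFin \o (fun t => L t (y t) (w t))).
  apply: (@ae_le_integrable _ _ _ mu _ _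
    (fun t => M / delta * (delta * expR (- delta * t)))).
  - exact: measurable_itv.
  - exact: mcost.
  - apply: integrableZl_EFin; first exact: measurable_itv.
    exact: integrable_discount.
  - by move: LM; apply: sub_ae => t LM; rewrite /= in_itv/= andbT.
have costE : cost l delta s y w =
    (\int[mu]_(t in `[s, +oo[) L t (y t) (w t))%:E.
  by rewrite /cost /Rintegral fineK//; exact: (integrable_fin_num _ iL).
have ham t X alpha xi : 0 <= t -> dini_supergradient Phi t X (alpha, xi) ->
    forall u, Omega u -> 0 <= alpha + dotp xi (f t X u) + L t X u.
  move=> t0 supg u Ou.
  by apply: (hamiltonian_ge0_ineq (Omega := Omega)) => //; exact: HJB.
have finiteT T : s <= T -> Phi s z <= Phi T (y T)
    + (\int[mu]_(t in `[s, +oo[) L t (y t) (w t)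
       + M / delta * expR (- delta * T)).
  move=> sT.
  have iLT : mu.-integrable `[s, T] (EFin \o (fun t => L t (y t) (w t))).
    by apply: integrableS iL => //; apply: subset_itvl; rewrite bnd_simp.
  rewrite -ys; apply: le_trans (finite_horizon_bound s0 sT K0 M0 cO cPhi cf
    (continuous_discounted cl) lipf lipL ham yB yM wO yE' iLT) _.
  by rewrite lerD2l; exact: Rintegral_discount_truncate.
rewrite costE lee_fin; apply/ler_addgt0Pr => e e0.
have e20 : 0 < e / 2 by rewrite divr_gt0.
have MB : 0 < M / delta + 1 by rewrite ltr_wpDl// divr_ge0// ltW.
near (pinfty_nbhs R) => T.
have sT : s <= T by near: T; apply: nbhs_pinfty_ge; exact: num_real.
have PhiT : Phi T (y T) <= e / 2.
  have : forall x : 'rV[R]_n, `|x| <= B -> Phi T x <= e / 2.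
    by near: T; exact: uniform_limit0_le.
  by apply; exact: yB.
have expT : M / delta * expR (- delta * T) <= e / 2.
  have : expR (- delta * T) < e / 2 / (M / delta + 1).
    near: T; apply: (cvgr_lt _ (cvg_expR_discount delta0)).
    by rewrite divr_gt0.
  rewrite ltr_pdivlMr// => /ltW; apply: le_trans.
  by rewrite mulrDr mulr1 mulrC lerDl; exact: expR_ge0.
apply: le_trans (finiteT T sT) _.
by rewrite addrCA lerD2l (splitr e) lerD.
Unshelve. all: by end_near. Qed.

End infinite_horizon.

Theorem proposition13 (R : realType) (n m : nat)
    (l : R -> 'rV[R]_n -> 'rV[R]_m -> R)
    (f : R -> 'rV[R]_n -> 'rV[R]_m -> 'rV[R]_n)
    (Omega : set 'rV[R]_m) (delta : R)
    (Omega_neq0 : Omega !=set0) (delta_gt0 : 0 < delta)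
    (A1 : lipschitz_data l f Omega)
    (A2 : linear_growth_data l f Omega)
    (A3 : continuous_data l f)
    (A4 : convex_data l f Omega delta)
    (A5 : compact Omega)
    (A6 : bounded_finite_cost_states l f Omega delta)
    (s : R) (z : 'rV[R]_n) (s_ge0 : 0 <= s)
    (xbar : R -> 'rV[R]_n) (ubar : R -> 'rV[R]_m)
    (Hbar : finite_cost_process l f Omega delta s z xbar ubar) :
  (exists Phi : R -> 'rV[R]_n -> R,
     dini_subsolution l f Omega delta Phi /\
     (Phi s z)%:E = cost l delta s xbar ubar) ->
  optimal_process l f Omega delta s z xbar ubar.
Proof.
move=> [Phi [subsol PhiE]]; split=> // y w fcp; rewrite -PhiE.
exact: subsolution_le_cost fcp.
Qed.
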